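(* Let $U,V,E_0,E_1$ be independent, with $\mathbb P(U=0)=\mathbb P(U=1)=\tfrac12$ and $V,E_0,E_1\sim\mathrm{Unif}(0,1)$. Let $T=\mathbf 1\{V\le p(U)\}$ with $p(0)=\tfrac15$, $p(1)=\tfrac45$, let $Y(a)=Q_{a,U}(E_a)$ for $a\in\{0,1\}$ and $Y=(1-T)Y(0)+TY(1)$, where, for $0\le e\le1$, $$Q_{0,0}(e)=3e,$$ $$Q_{0,1}(e)=\begin{cases}5e,&0\le e\le\frac15,\\ 1+\frac{10}{3}(e-\frac15),&\frac15<e\le\frac12,\\ 2+2(e-\frac12),&\frac12<e\le1,\end{cases}$$ $$Q_{1,0}(e)=\begin{cases}2e,&0\le e\le\frac12,\\ 2+2(e-\frac12),&\frac12<e\le1,\end{cases}$$ $$Q_{1,1}(e)=\begin{cases}5e,&0\le e\le\frac15,\\ 2+\frac54(e-\frac15),&\frac15<e\le1.\end{cases}$$ Let $\mu_a=\mathcal L(Y(a))$ and $\nu_a=\mathcal L(Y\mid T=a)$, and let $\Psi_\Lambda(\mu)=\beta_0(\{y:f_\mu(y)\ge 0.20\})$, where $f_\mu$ is the density of $\mu$. Then $$\Psi_\Lambda(\mu_0)=\Psi_\Lambda(\nu_0)=1,\qquad \Psi_\Lambda(\mu_1)=\Psi_\Lambda(\nu_1)=2,$$ so that $\Psi_\Lambda(\mu_1)-\Psi_\Lambda(\mu_0)=1=\Psi_\Lambda(\nu_1)-\Psi_\Lambda(\nu_0)$. Nevertheless weak ignorability fails, because $\mu_1\ne\nu_1$.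
   Context: $\beta_0(A)$ is the number of connected components of $A$. Densities are with respect to Lebesgue measure on $\mathbb R$; the laws here have piecewise-constant densities (constant on the interiors of $[0,1],[1,2],[2,3]$ and zero outside $[0,3]$), and the superlevel set $\{y:f_\mu(y)\ge0.20\}$ is understood using the natural closed representative, i.e. as the closure of the corresponding superlevel region, so endpoint values do not matter. There are no observed covariates; weak ignorability means that $Y(t)$ is independent of $T$ for each $t\in\{0,1\}$. *)

(* Defs.v *)
From HB Require Import structures.
From mathcomp Require Import all_boot all_order all_algebra finmap.
From mathcomp Require Import all_classical all_reals all_analysis.
From mathcomp Require Import measurable_realfun.
Import Order.TTheory GRing.Theory Num.Theory.
Import numFieldNormedType.Exports.

Set Implicit Arguments.
Unset Strict Implicit.
Unset Printing Implicit Defensive.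

Local Open Scope classical_set_scope.
Local Open Scope ring_scope.

Section probability_notions.
Context (d : measure_display) (Om : measurableType d) (R : realType).
Variable P : probability Om R.

Definition mutually_independent (I : finType) (X : I -> {RV P >-> R}) : Prop :=
  forall (J : {set I}) (A : I -> set R),
    (forall i, i \in J -> measurable (A i)) ->
    P (\bigcap_(i in [set i | i \in J]) (X i @^-1` A i)) =
    (\prod_(i in J) P (X i @^-1` A i))%E.

(* Equals 0 when P B = 0. *)
Definition cond_prob (B A : set Om) : \bar R :=
  (fine (P (A `&` B)) / fine (P B))%:E.

Definition cond_distribution (X : {RV P >-> R}) (B : set Om) :
    set R -> \bar R :=
  pushforward (cond_prob B) X.

End probability_notions.

Section level_set_functional.
Context (R : realType).
Implicit Types (mu nu : set R -> \bar R) (f : R -> R).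

(* Laws are functions on all sets, but only their values on Borel sets matter. *)
Definition same_law mu nu : Prop :=
  forall A : set R, measurable A -> mu A = nu A.

Definition is_density mu f : Prop :=
  [/\ measurable_fun setT f, (forall y, 0 <= f y) &
      same_law mu (fun A => (\int[lebesgue_measure]_(y in A) (f y)%:E)%E)].

(* The values at 0, 1, 2 and 3 are left free. *)
Definition piecewise_constant f : Prop :=
  (forall k : nat, (k < 3)%N ->
     exists c : R, forall y, k%:R < y < k.+1%:R -> f y = c) /\
  (forall y, y \notin `[0, 3] -> f y = 0).

(* Two piecewise constant densities of mu differ at most at 0, 1, 2 and 3. *)
Definition density mu : R -> R :=
  xget (fun=> 0) [set f | is_density mu f /\ piecewise_constant f].

(* The interior discards isolated points and the closure fills isolated gaps:
   for piecewise constant f and c > 0 the values of f at 0, 1, 2 and 3 do not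
   matter, and the result is the closure of the union of those of the
   intervals ]0, 1[, ]1, 2[, ]2, 3[ on which f >= c. *)
Definition superlevel f (c : R) : set R := closure [set y | c <= f y]°.

(* fset_set sends an infinite set to fset0, so a nonzero value of betti0 A
   is always a true count. *)
Definition betti0 (A : set R) : nat :=
  #|` fset_set [set connected_component A x | x in A] |%fset.

Definition Psi (c : R) mu : nat := betti0 (superlevel (density mu) c).

End level_set_functional.

Section structural_model.
Context (R : realType).

Definition propensity (u : bool) : R := if u then 4 / 5 else 1 / 5.

Definition quantile (a u : bool) (e : R) : R :=
  match a, u with
  | false, false => 3 * e
  | false, true =>
      if e <= 1 / 5 then 5 * e
      else if e <= 1 / 2 then 1 + 10 / 3 * (e - 1 / 5)
      else 2 + 2 * (e - 1 / 2)
  | true, false =>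
      if e <= 1 / 2 then 2 * e else 2 + 2 * (e - 1 / 2)
  | true, true =>
      if e <= 1 / 5 then 5 * e else 2 + 5 / 4 * (e - 1 / 5)
  end.

Lemma measurable_quantile a u : measurable_fun setT (quantile a u).
Proof.
have lin (b c e : R) : measurable_fun setT (fun x : R => b + c * (x - e)).
  apply: measurable_funD => //; apply: measurable_funM => //.
  exact: measurable_funB.
have mulc (c : R) : measurable_fun setT (fun x : R => c * x).
  exact: measurable_funM.
case: a u => [] [] /=; repeat (apply: measurable_fun_ifT => //;
  try exact: measurable_fun_ler); by [exact: lin|exact: mulc].
Qed.

Context (d : measure_display) (Om : measurableType d) (P : probability Om R).
Variables U V E0 E1 : {RV P >-> R}.

(* U is real valued but almost surely 0 or 1, so it is read as the boolean
   U w == 1; the indices 0 and 1 of treatment arms are booleans as well. *)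
Definition treatment (w : Om) : R :=
  if V w <= propensity (U w == 1) then 1 else 0.

Definition potential_outcome (a : bool) (w : Om) : R :=
  quantile a (U w == 1) ((if a then E1 else E0) w).

Definition outcome (w : Om) : R :=
  (1 - treatment w) * potential_outcome false w
  + treatment w * potential_outcome true w.

Lemma measurable_U1 : measurable_fun setT (fun w => U w == 1).
Proof. by apply: measurable_fun_eqr => //; exact: measurable_funP. Qed.

Lemma measurable_treatment : measurable_fun setT treatment.
Proof.
apply: measurable_fun_ifT => //; apply: measurable_fun_ler => //.
by rewrite /propensity; apply: measurable_fun_ifT => //; exact: measurable_U1.
Qed.

HB.instance Definition _ :=
  isMeasurableFun.Build _ _ _ _ treatment measurable_treatment.

Lemma measurable_potential_outcome a :
  measurable_fun setT (potential_outcome a).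
Proof.
rewrite /potential_outcome.
have -> : (fun w => quantile a (U w == 1) ((if a then E1 else E0) w)) =
    (fun w => if U w == 1 then quantile a true ((if a then E1 else E0) w)
              else quantile a false ((if a then E1 else E0) w)).
  by apply/funext => w; case: (U w == 1).
apply: measurable_fun_ifT; first exact: measurable_U1.
all: by apply: measurableT_comp; [exact: measurable_quantile|case: a].
Qed.

HB.instance Definition _ a := isMeasurableFun.Build _ _ _ _
  (potential_outcome a) (measurable_potential_outcome a).

Lemma measurable_outcome : measurable_fun setT outcome.
Proof.
apply: measurable_funD; apply: measurable_funM;
  by [exact: measurable_potential_outcome|exact: measurable_treatment|
      apply: measurable_funB => //; exact: measurable_treatment].
Qed.

HB.instance Definition _ :=
  isMeasurableFun.Build _ _ _ _ outcome measurable_outcome.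

Definition weakly_ignorable : Prop :=
  forall t : bool, mutually_independent
    (tnth [tuple potential_outcome t : {RV P >-> R};
                 treatment : {RV P >-> R}]).

End structural_model.

(* Main.v *)
(* Conditionally on U, each potential outcome is a piecewise affine increasing
   function of a uniform variable, mapping the k-th interval of a subdivision of
   ]0, 1] onto ]k, k+1]; its law therefore has density equal to the length of
   that interval on ]k, k+1]. Mixing over U with weights (1/2, 1/2) gives mu_a,
   and with weights (P(T = a | U = 0), P(T = a | U = 1)) gives nu_a, because
   P(T = a) = 1/2. The densities on the three unit intervals are
     mu_0 : 4/15, 19/60, 5/12     nu_0 : 23/75, 49/150, 11/30
     mu_1 : 7/20, 0, 13/20        nu_1 : 13/50, 0, 37/50
   and under ignorability mu_1 and nu_1 would coincide. *)
Require Import Defs.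
From HB Require Import structures.
From mathcomp Require Import all_boot all_order all_algebra finmap.
From mathcomp Require Import all_classical all_reals all_analysis.
From mathcomp Require Import measurable_realfun ring lra.
Import Order.TTheory GRing.Theory Num.Theory.
Import numFieldNormedType.Exports.

Set Implicit Arguments.
Unset Strict Implicit.
Unset Printing Implicit Defensive.

Local Open Scope classical_set_scope.
Local Open Scope ring_scope.

(** * Laws with constant density on the unit intervals of ]0, 3] *)

Section histogram.
Context (R : realType).
Implicit Types (k : nat) (A : set R) (c : nat -> R).

Local Notation lambda := (@lebesgue_measure R).

(** Half-open, so that the bins tile ]0, 3] exactly and an increasing affine map pulls them back to
    intervals of the same shape. *)
Definition bin k : set R := `]k%:R, k.+1%:R].

Definition bin_mass A k : R := fine (lambda (A `&` bin k)).

Definition histogram c A : \bar R := (\sum_(k < 3) c k * bin_mass A k)%:E.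

Definition histogram_pdf c (y : R) : R := \sum_(k < 3) c k * \1_(bin k) y.

Lemma measurable_bin k : measurable (bin k).
Proof. exact: measurable_itv. Qed.

Lemma lebesgue_measure_bin k : lambda (bin k) = 1%E.
Proof.
rewrite lebesgue_measure_itv /= lte_fin ltr_nat ltnSn -EFinD.
by rewrite -addn1 natrD addrAC subrr add0r.
Qed.

Lemma bin_massE A k : measurable A -> (bin_mass A k)%:E = lambda (A `&` bin k).
Proof.
move=> mA; rewrite /bin_mass fineK// ge0_fin_numE//.
apply: (@le_lt_trans _ _ (lambda (bin k))); last first.
  by rewrite lebesgue_measure_bin ltry.
have mk := measurable_bin k.
by apply: le_measure; rewrite ?inE//; exact: measurableI.
Qed.

Lemma measurable_histogram_pdf c : measurable_fun setT (histogram_pdf c).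
Proof.
apply: measurable_sum => k; apply: measurable_funM => //.
by apply: measurable_indic; exact: measurable_bin.
Qed.

Lemma histogram_pdf_density (mu : set R -> \bar R) c :
  (forall k, 0 <= c k) -> same_law mu (histogram c) ->
  is_density mu (histogram_pdf c).
Proof.
move=> c0 muc; split; first exact: measurable_histogram_pdf.
- by move=> y; apply: sumr_ge0 => k _; rewrite mulr_ge0.
move=> A mA; rewrite muc// /histogram /histogram_pdf.
under [in RHS]eq_integral do rewrite -sumEFin.
rewrite ge0_integral_sum//=.
- rewrite -sumEFin; apply: eq_bigr => k _.
  under eq_integral do rewrite EFinM.
  rewrite ge0_integralZl_EFin//=.
  + rewrite integral_indic//; last exact: measurable_bin.
    by rewrite EFinM bin_massE// setIC.
  + by apply/measurable_EFinP/measurable_indic; exact: measurable_bin.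
- move=> k; apply/measurable_EFinP/measurable_funM => //.
  by apply: measurable_indic; exact: measurable_bin.
- by move=> k x _; rewrite lee_fin mulr_ge0.
Qed.

Lemma in_bin_inj k l (y : R) : k%:R < y < k.+1%:R -> bin l y -> l = k.
Proof.
rewrite /bin/= in_itv/= => /andP[ky yk] /andP[ly yl].
have := lt_le_trans ky yl; have := lt_trans ly yk.
by rewrite !ltr_nat !ltnS => lk kl; apply/eqP; rewrite eqn_leq lk.
Qed.

Lemma histogram_pdf_bin c k (y : R) : (k < 3)%N -> k%:R < y < k.+1%:R ->
  histogram_pdf c y = c k.
Proof.
move=> k3 ky; rewrite /histogram_pdf (bigD1 (Ordinal k3))//= big1 ?addr0.
  rewrite indicE mem_set ?mulr1// /bin/= in_itv/=.
  by case/andP: ky => -> /ltW.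
move=> l lk; rewrite indicE memNset ?mulr0// => /(in_bin_inj ky) /eqP.
by rewrite -(inj_eq val_inj)/= in lk; rewrite (negbTE lk).
Qed.

Lemma histogram_pdf_out c (y : R) : y \notin `[0, 3] -> histogram_pdf c y = 0.
Proof.
move=> y03; rewrite /histogram_pdf big1// => k _.
rewrite indicE memNset ?mulr0// /bin/= in_itv/= => /andP[ky yk].
move: y03; rewrite in_itv/= => /negP; apply.
by rewrite (le_trans (ler0n _ k) (ltW ky)) (le_trans yk)// ler_nat ltn_ord.
Qed.

(** A constant value of a density is recovered from the law as the mass of an open interval of
    length 1. Any two such densities of [mu] therefore agree inside the unit intervals. *)
Lemma density_bin (mu : set R -> \bar R) (f : R -> R) k (a : R) :
  is_density mu f -> (forall y, k%:R < y < k.+1%:R -> f y = a) ->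
  mu `]k%:R, k.+1%:R[%classic = a%:E.
Proof.
move=> [_ _ muf] fa; rewrite muf//.
rewrite (eq_integral (cst a%:E)); last first.
  by move=> y; rewrite inE/= in_itv/= => /fa ->.
rewrite integral_cst//= lebesgue_measure_itv /= lte_fin ltr_nat ltnSn -EFinD.
by rewrite -addn1 natrD addrAC subrr add0r mule1.
Qed.

(** [density] is an arbitrary choice made by [xget]. The set chosen from is inhabited by
    [histogram_pdf c], and the choice has the same constants because both are masses of the open
    unit intervals under [mu]. *)
Lemma density_histogram (mu : set R -> \bar R) c :
  (forall k, 0 <= c k) -> same_law mu (histogram c) ->
  (forall k (y : R), (k < 3)%N -> k%:R < y < k.+1%:R -> density mu y = c k) /\
  (forall y : R, y \notin `[0, 3] -> density mu y = 0).
Proof.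
move=> c0 muc; have hd := histogram_pdf_density c0 muc.
have [|fd [fc f0]] := @xgetPex _ (fun=> 0 : R)
    [set f : R -> R | is_density mu f /\ piecewise_constant f].
  exists (histogram_pdf c); split => //; split.
    by move=> k k3; exists (c k) => y; exact: histogram_pdf_bin.
  by move=> y; exact: histogram_pdf_out.
split=> // k y k3 ky; have [a fa] := fc k k3.
suff -> : c k = a by exact: fa.
apply: EFin_inj; rewrite -(density_bin fd fa).
rewrite -(density_bin (k := k) (a := c k) hd)// => z; exact: histogram_pdf_bin.
Qed.

End histogram.

(** * Closed superlevel sets and their connected components *)

Section superlevel_components.
Context (R : realType).

Lemma closure_itvoo (a b : R) : a < b -> closure `]a, b[ = `[a, b]%classic.
Proof.
move=> ab; apply/seteqP; split; first exact: itv_closure.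
move=> z /=; rewrite in_itv/= => /andP[az zb] B /nbhs_ballP[e /= e0 zeB].
(* [t] is the fraction of the way from [z] to the midpoint of the interval. Since 0 < t <= 1 the new
   point lies strictly inside, and it moves by at most t (b - a) / 2 <= e / 2. *)
pose t : R := Num.min 1 (e / (b - a)).
have ba0 : 0 < b - a by rewrite subr_gt0.
have t0 : 0 < t by rewrite lt_min ltr01 divr_gt0.
have t1 : t <= 1 by rewrite ge_min lexx.
have te : t * (b - a) <= e by rewrite -ler_pdivlMr// ge_min lexx orbT.
exists (z + t * ((a + b) / 2 - z)); split.
  by rewrite /= in_itv/=; apply/andP; split; nra.
by apply: zeB; rewrite /ball/= ltr_norml; apply/andP; split; nra.
Qed.

(** The open set [O] already lies in the interior of the level set, so the closure of that interior
    is squeezed between [closure O] and [S]. The values of [f] on the rest of [S] need not be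
    known. *)
Lemma superlevelE (f : R -> R) (c : R) (O S : set R) :
  open O -> closure O = S -> O `<=` [set y | c <= f y] ->
  [set y | c <= f y] `<=` S -> superlevel f c = S.
Proof.
move=> oO OS Of fS; apply/seteqP; split.
  rewrite /superlevel -[X in _ `<=` X]OS.
  rewrite [X in _ `<=` X](closure_id _).1; last exact: closed_closure.
  by apply: closureS; rewrite OS; exact: subset_trans (@interior_subset _ _) fS.
by rewrite -OS; apply: closureS; rewrite -open_subsetE.
Qed.

Lemma betti0_itv (a b : R) : a <= b -> betti0 `[a, b]%classic = 1%N.
Proof.
move=> ab; rewrite /betti0; set C := [set _ | _ in _].
suff -> : C = [set `[a, b]%classic] by rewrite fset_set1 cardfs1.
have cc (x : R) : `[a, b]%classic x ->
    connected_component `[a, b] x = `[a, b]%classic.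
  by move=> abx; apply: connected_component_id => //; exact: segment_connected.
apply/seteqP; split => [_ [x abx <-]|_ ->]; first exact: cc.
have aab : `[a, b]%classic a by rewrite /= in_itv/= lexx.
by exists a => //; exact: cc.
Qed.

Lemma betti0_itvU (a b a' b' : R) : a <= b -> b < a' -> a' <= b' ->
  betti0 (`[a, b] `|` `[a', b']) = 2%N.
Proof.
move=> ab ba ab'; rewrite /betti0; set S := `[a, b] `|` `[a', b'].
(* A connected component is an interval, so one meeting both segments would contain the midpoint [m]
   of the gap, which is outside [S]. *)
have SlP (x y : R) :
    S x -> S y -> x <= b -> connected_component S x y -> y <= b.
  move=> Sx Sy xb cxy; rewrite leNgt; apply/negP => by_.
  pose m := (b + a') / 2.
  have : connected_component S x m.
    have /connected_intervalP ci := @component_connected _ S x.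
    apply: (ci x y) => //; first exact: connected_component_refl.
    case: Sy => /=; rewrite in_itv/= => /andP[? ?]; rewrite /m; lra.
  by move/connected_component_sub => [|]; rewrite /= in_itv/= /m; lra.
have cl (x : R) : `[a, b]%classic x ->
    connected_component S x = `[a, b]%classic.
  move=> abx; have Sx : S x by left.
  apply/seteqP; split => y.
    move=> cxy; have Sy := connected_component_sub cxy.
    have := SlP x y Sx Sy; move: abx Sy; rewrite /S /= !in_itv/=.
    by move=> /andP[_ ->] h /(_ isT cxy) yb; case: h => [//|]; lra.
  by apply: connected_component_max => //; [left|exact: segment_connected].
have cr (x : R) : `[a', b']%classic x ->
    connected_component S x = `[a', b']%classic.
  move=> abx; have Sx : S x by right.
  apply/seteqP; split => y.
    move=> cxy; have Sy := connected_component_sub cxy.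
    have := SlP y x Sy Sx; move: abx Sy; rewrite /S /= !in_itv/=.
    move=> abx [/andP[_ yb]|//] /(_ yb (connected_component_sym cxy)); lra.
  by apply: connected_component_max => //; [right|exact: segment_connected].
have -> : [set connected_component S x | x in S] =
    [set `[a, b]%classic; `[a', b']%classic].
  apply/seteqP; split => [_ [x [abx|abx] <-]|_ [->|->]].
  - by left; exact: cl.
  - by right; exact: cr.
  - have aab : `[a, b]%classic a by rewrite /= in_itv/= lexx.
    by exists a; [left|exact: cl].
  - have aab : `[a', b']%classic a' by rewrite /= in_itv/= lexx.
    by exists a'; [right|exact: cr].
(* The cardinality is 2 only if the two components differ; the point [a] belongs to the first
   alone. *)
rewrite fset_setU1// fset_set1 cardfs2.
suff -> : `[a, b]%classic != `[a', b']%classic by [].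
apply/eqP => /seteqP[/(_ a)] /=; rewrite !in_itv/= lexx ab => /(_ isT); lra.
Qed.

End superlevel_components.

(** * Image of the uniform law under a piecewise affine quantile function *)

Section piecewise_affine_quantile.
Context (R : realType).
Implicit Types A B : set R.

Local Notation lambda := (@lebesgue_measure R).

(** By uniqueness of Lebesgue measure: [a] times its image under x -> a x + b gives half-open
    intervals their length. *)
Lemma lebesgue_measure_affine (a b : R) A : 0 < a -> measurable A ->
  lambda ((fun x => a * x + b) @^-1` A) = (a^-1%:E * lambda A)%E.
Proof.
move=> a0 mA; pose f (x : R) : measurableTypeR R := a * x + b.
have mf : measurable_fun [set: measurableTypeR R] f.
  by apply: measurable_funD => //; exact: measurable_funM.
suff -> : lambda A = (a%:E * lambda (f @^-1` A))%E.
  by rewrite muleA -EFinM mulVf ?gt_eqF// mul1e.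
have := @lebesgue_measure_unique R
  (mscale (NngNum (ltW a0)) (pushforward lambda f)).
apply=> // _ [[x y] _ <-].
rewrite /= /mscale/= /pushforward.
rewrite (_ : _ @^-1` _ = `](x - b) / a, (y - b) / a]%classic); last first.
  by apply/seteqP; split => z; rewrite /f /= !in_itv/= ltr_pdivrMr//
    ler_pdivlMr// ltrBlDr lerBrDr mulrC.
rewrite !lebesgue_measure_itv/= !lte_fin ltr_pM2r ?invr_gt0// ltrD2r.
case: ifPn => _; last by rewrite mule0.
by rewrite -!EFinD -EFinM; congr EFin; field; rewrite gt_eqF.
Qed.

(** The null point 0 is dropped so that the unit interval can be cut into half-open pieces. *)
Lemma uniform_probE B : measurable B ->
  uniform_prob (@ltr01 R) B = lambda (B `&` `]0, 1]).
Proof.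
move=> mB; rewrite /uniform_prob integral_uniform_pdf.
rewrite (eq_integral (cst 1%E)); last first.
  move=> x; rewrite inE/= in_itv/= /uniform_pdf => -[_ ->].
  by rewrite subr0 invr1.
rewrite integral_cst//= ?mul1e; last exact: measurableI.
have -> : `[0, 1]%classic = [set 0] `|` `]0, 1]%classic :> set R.
  by rewrite setU1itv// bnd_simp.
rewrite setIUr measureU.
- rewrite [X in (X + _)%E](_ : _ = 0%E) ?add0e//.
  apply/eqP; rewrite eq_le measure_ge0 andbT -(lebesgue_measure_set1 (0 : R)).
  by apply: le_measure; rewrite ?inE//; exact: measurableI.
- exact: measurableI.
- exact: measurableI.
- apply/seteqP; split => // x [] [_ ->] [_] /=; by rewrite in_itv/= ltxx.
Qed.

Lemma lebesgue_measure_subdivision (q : nat -> R) (n : nat) B :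
  (forall k, q k <= q k.+1) -> measurable B ->
  lambda (B `&` `]q 0, q n]) =
  (\sum_(k < n) lambda (B `&` `]q k, q k.+1]))%E.
Proof.
move=> qn mB; elim: n => [|n IH].
  by rewrite big_ord0 set_itvoc0 setI0 measure0.
have q0n : q 0 <= q n by elim: n {IH} => // n /le_trans; apply.
rewrite big_ord_recr/= -IH -measureU.
- rewrite -setIUr; congr (lambda (_ `&` _)); apply/seteqP; split=> x /=.
    rewrite !in_itv/= => /andP[q0x xq]; rewrite q0x/= xq andbT.
    by apply/orP; rewrite orbC -implyNb -leNgt; apply/implyP.
  rewrite !in_itv/= => -[/andP[-> /le_trans->]//|/andP[qx ->]].
  by rewrite (le_lt_trans q0n qx).
- exact: measurableI.
- exact: measurableI.
- apply/seteqP; split => // x /= [[_ +] [_ +]].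
  rewrite !in_itv/= => /andP[_ xq] /andP[qx _].
  by have := lt_le_trans qx xq; rewrite ltxx.
Qed.

Lemma lebesgue_measure_bin_preimage (k : nat) (x y : R) (Q : R -> R) A :
  x <= y -> measurable A ->
  (forall e, x < e <= y -> Q e = k%:R + (e - x) / (y - x)) ->
  lambda (Q @^-1` A `&` `]x, y]) = ((y - x) * bin_mass A k)%:E.
Proof.
(* With equal endpoints the interval is empty and both sides vanish; this is the case of a bin that
   the quantile function jumps over. *)
rewrite le_eqVlt => /predU1P[<- _ _|xy mA hQ].
  by rewrite set_itvoc0 setI0 measure0 subrr mul0r.
have yx0 : 0 < y - x by rewrite subr_gt0.
have mk := @measurable_bin R k.
rewrite EFinM bin_massE//.
(* The length y - x is written as the inverse of the slope of [Q] on the interval. The affine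
   extension of [Q] pulls the k-th bin back to exactly ]x, y]. *)
rewrite -[X in (X%:E * _)%E]invrK.
rewrite -(lebesgue_measure_affine (k%:R - x / (y - x))).
- congr (lambda _); apply/seteqP; split => e /=.
    rewrite /bin/= !in_itv/= => -[Ae exy].
    have -> : (y - x)^-1 * e + (k%:R - x / (y - x)) = Q e by rewrite hQ//; ring.
    split=> //; rewrite hQ//.
    case/andP: exy => xe ey.
    rewrite ltrDl divr_gt0 ?subr_gt0//= -addn1 natrD lerD2l.
    by rewrite ler_pdivrMr// mul1r lerD2r.
  rewrite /bin/= !in_itv/= => -[Ae ekk].
  have exy : x < e <= y.
    move: ekk; rewrite -addn1 natrD.
    have -> : (y - x)^-1 * e + (k%:R - x / (y - x)) = k%:R + (e - x) / (y - x).
      by ring.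
    rewrite ltrDl lerD2l ler_pdivrMr// mul1r lerD2r.
    by rewrite pmulr_lgt0 ?invr_gt0// subr_gt0.
  by split=> //; rewrite hQ//; move: Ae; congr (A _); ring.
- by rewrite invr_gt0.
- exact: measurableI.
Qed.

(** Cutting ]0, 1] at the breakpoints, each piece is stretched onto one bin, so its length becomes
    the height of the density there. *)
Lemma uniform_prob_quantile (q : nat -> R) (Q : R -> R) A :
  q 0 = 0 -> q 3 = 1 -> (forall k, q k <= q k.+1) ->
  (forall k e, q k < e <= q k.+1 -> Q e = k%:R + (e - q k) / (q k.+1 - q k)) ->
  measurable_fun setT Q -> measurable A ->
  uniform_prob (@ltr01 R) (Q @^-1` A) = histogram (fun k => q k.+1 - q k) A.
Proof.
move=> q0 q3 qn hQ mQ mA.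
have mQA : measurable (Q @^-1` A).
  by rewrite -[X in measurable X]setTI; exact: mQ.
rewrite uniform_probE// -q0 -[X in `]_, X]]q3 lebesgue_measure_subdivision//.
rewrite /histogram -sumEFin; apply: eq_bigr => k _.
by rewrite (lebesgue_measure_bin_preimage (k := k))// => e; exact: hQ.
Qed.

End piecewise_affine_quantile.

(** * The functional on histograms with one or two modes *)

Section Psi_histogram.
Context (R : realType) (mu : set R -> \bar R) (c : nat -> R) (a : R).
Hypotheses (a0 : 0 < a) (c0 : forall k, 0 <= c k).
Hypothesis muc : same_law mu (histogram c).

Lemma Psi_histogram_unimodal : (forall k, (k < 3)%N -> a <= c k) ->
  Psi a mu = 1%N.
Proof.
move=> ac; have [fc f0] := density_histogram c0 muc.
rewrite /Psi; have -> : superlevel (density mu) a = `[0, 3]%classic;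
  last by apply: betti0_itv; lra.
(* The density is unknown at the integers, so the open set avoids them; its closure restores 1 and 2
   and joins the three pieces. *)
apply: (@superlevelE _ _ _ (`]0, 1[ `|` `]1, 2[ `|` `]2, 3[)%classic).
- by do ?[exact: interval_open|apply: openU].
- rewrite !closureU !closure_itvoo; [|lra..].
  apply/seteqP; split => y /=; rewrite !in_itv/=.
    by case=> [[]|] /andP[]; lra.
  move=> /andP[y0 y3]; have [y1|y1] := leP y 1; first by left; left; rewrite y0.
  have [y2|y2] := leP y 2; first by left; right; rewrite ltW.
  by right; rewrite ltW.
- by move=> y /=; rewrite !in_itv/= => -[[|]|];
    [move=> /(fc 0) ->|move=> /(fc 1) ->|move=> /(fc 2) ->]; rewrite ?ac.
- move=> y /= afy; apply/negPn/negP => /f0 y0.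
  by move: afy; rewrite y0 leNgt a0.
Qed.

Lemma Psi_histogram_bimodal : a <= c 0 -> c 1 < a -> a <= c 2 ->
  Psi a mu = 2%N.
Proof.
move=> ac0 ac1 ac2; have [fc f0] := density_histogram c0 muc.
rewrite /Psi; have -> : superlevel (density mu) a = `[0, 1] `|` `[2, 3];
  last by apply: betti0_itvU; lra.
apply: (@superlevelE _ _ _ (`]0, 1[ `|` `]2, 3[)%classic).
- by do ?[exact: interval_open|apply: openU].
- by rewrite closureU !closure_itvoo//; lra.
- by move=> y /=; rewrite !in_itv/= => -[/(fc 0) ->|/(fc 2) ->].
(* A point at level [a] > 0 lies in [0, 3], where the density may be nonzero, and not in ]1, 2[,
   where it is below [a]. *)
- move=> y /= afy; rewrite !in_itv/=.
  have : y \in `[0, 3].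
    by apply/negPn/negP => /f0 y0; move: afy; rewrite y0 leNgt a0.
  rewrite in_itv/= => /andP[-> ->]; rewrite andbT; apply/orP; rewrite !leNgt.
  rewrite -negb_and; apply/negP => /(fc 1 _ isT) y0.
  by move: afy; rewrite y0 leNgt ac1.
Qed.

End Psi_histogram.

(** * Marginal and conditional laws in the structural model *)

Section model.
Context (R : realType) (d : measure_display) (Om : measurableType d).
Context (P : probability Om R) (U V E0 E1 : {RV P >-> R}).
Hypothesis hindep : mutually_independent (tnth [tuple U; V; E0; E1]).
Hypothesis hU1 : P (U @^-1` [set 1]) = (1 / 2)%:E.
Hypothesis hV : same_law (distribution P V) (uniform_prob (@ltr01 R)).
Hypothesis hE0 : same_law (distribution P E0) (uniform_prob (@ltr01 R)).
Hypothesis hE1 : same_law (distribution P E1) (uniform_prob (@ltr01 R)).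

Local Notation E a := (if a then E1 else E0).
Local Notation Y a := (potential_outcome U E0 E1 a).
Local Notation T := (treatment U V).

(* A repeated breakpoint makes the k-th interval empty: the quantile function
   then jumps over ]k, k+1]. *)
Definition breakpoint (a u : bool) : nat -> R :=
  nth 1 (match a, u with
         | false, false => [:: 0; 1 / 3; 2 / 3]
         | false, true => [:: 0; 1 / 5; 1 / 2]
         | true, false => [:: 0; 1 / 2; 1 / 2]
         | true, true => [:: 0; 1 / 5; 1 / 5]
         end).

(** Height on the k-th bin of the density of the arm [a] outcome given [u]. The default 1 of [nth]
    ends the third interval at 1 and makes the weight 0 for k >= 3. *)
Definition weight (a u : bool) (k : nat) : R :=
  breakpoint a u k.+1 - breakpoint a u k.

Lemma breakpointS a u k : breakpoint a u k <= breakpoint a u k.+1.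
Proof. by case: a u k => [] [] [|[|[|[|k]]]]; rewrite /breakpoint/=; lra. Qed.

Lemma weight_ge0 a u k : 0 <= weight a u k.
Proof. by rewrite subr_ge0 breakpointS. Qed.

(** A check of the closed forms piece by piece; it is vacuous at a repeated breakpoint and for k >=
    3, where both endpoints are 1. *)
Lemma quantile_breakpoint a u k e :
  breakpoint a u k < e <= breakpoint a u k.+1 ->
  quantile a u e = k%:R + (e - breakpoint a u k) / weight a u k.
Proof.
rewrite /weight; case: a u k => [] [] [|[|[|[|k]]]];
  rewrite /breakpoint/= => /andP[];
  do ?[case: ifPn; rewrite -?ltNge]; move=> *; try lra; by field.
Qed.

Lemma quantile_law a u A : measurable A ->
  P (E a @^-1` (quantile a u @^-1` A)) = histogram (weight a u) A.
Proof.
move=> mA; have mQ := measurable_quantile a u.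
have mQA : measurable (quantile a u @^-1` A).
  by rewrite -[X in measurable X]setTI; exact: mQ.
transitivity (uniform_prob (@ltr01 R) (quantile a u @^-1` A)).
  by case: a mQ mQA => mQ mQA; [exact: hE1|exact: hE0].
apply: uniform_prob_quantile => //.
- by case: a u {mQ mQA} => [] [].
- by case: a u {mQ mQA} => [] [].
- exact: breakpointS.
- exact: quantile_breakpoint.
Qed.

(** The false case is the complement of 1, in agreement with the reading of [U] as the boolean
    [U w == 1], so the two events partition the whole sample space. *)
Definition U_event (u : bool) : set R := if u then [set 1] else ~` [set 1].

Lemma measurable_U_event u : measurable (U_event u).
Proof. by case: u => //=; apply: measurableC. Qed.

Lemma U_eventE w u : U_event u (U w) <-> (U w == 1) = u.
Proof.
by case: u => /=; [split=> /eqP|split=> [/eqP/negbTE|/negbT/eqP]].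
Qed.

Lemma P_U_event u : P (U @^-1` U_event u) = (1 / 2)%:E.
Proof.
case: u => //=; rewrite -preimage_setC probability_setC ?hU1.
  by rewrite -EFinB; congr EFin; field.
by rewrite -[X in measurable X]setTI; exact: measurable_funP.
Qed.

Definition V_event (t u : bool) : set R :=
  if t then `]-oo, propensity R u]%classic else ~` `]-oo, propensity R u].

Definition treatment_prob (t u : bool) : R :=
  if t then propensity R u else 1 - propensity R u.

Lemma measurable_V_event t u : measurable (V_event t u).
Proof. by case: t => //=; apply: measurableC. Qed.

Lemma P_V_event t u : P (V @^-1` V_event t u) = (treatment_prob t u)%:E.
Proof.
have hp : P (V @^-1` `]-oo, propensity R u]) = (propensity R u)%:E.
  have p01 : 0 < propensity R u < 1 by rewrite /propensity; case: u; lra.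
  transitivity (uniform_prob (@ltr01 R) `]-oo, propensity R u]%classic).
    exact: hV.
  rewrite uniform_probE//.
  have -> : `]-oo, propensity R u] `&` `]0, 1] = `]0, propensity R u]%classic.
    apply/seteqP; split => x /=; rewrite !in_itv/=.
      by case=> -> /andP[->].
    by move=> /andP[-> xp]; split=> //=; lra.
  rewrite lebesgue_measure_itv/= lte_fin; case/andP: p01 => -> _.
  by rewrite oppr0 adde0.
case: t => //=; rewrite -preimage_setC probability_setC ?hp//.
by rewrite -[X in measurable X]setTI; exact: measurable_funP.
Qed.

Lemma indepUVE a (A B C : set R) :
  measurable A -> measurable B -> measurable C ->
  P (U @^-1` A `&` V @^-1` B `&` E a @^-1` C) =
  (P (U @^-1` A) * P (V @^-1` B) * P (E a @^-1` C))%E.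
Proof.
move=> mA mB mC.
(* The noise of the other arm is given the whole line, which contributes a factor 1. *)
pose S := tnth [tuple A; B; if a then setT else C; if a then C else setT].
have mS : forall i, i \in [set: 'I_4]%SET -> measurable (S i).
  by move=> [[|[|[|[|m]]]] i4] _ //; rewrite /S/tnth/=; case: (a) => /=.
have := @hindep _ _ mS.
have -> : \bigcap_(i in [set i | i \in [set: 'I_4]%SET])
      tnth [tuple U; V; E0; E1] i @^-1` S i =
    U @^-1` A `&` V @^-1` B `&` E a @^-1` C.
  apply/seteqP; split => w.
    move=> h; have h0 := h (@Ordinal 4 0 isT) (finset.in_setT _).
    have h1 := h (@Ordinal 4 1 isT) (finset.in_setT _).
    have h2 := h (@Ordinal 4 2 isT) (finset.in_setT _).
    have h3 := h (@Ordinal 4 3 isT) (finset.in_setT _).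
    by split => //; move: h2 h3; rewrite /S /tnth/=; case: (a).
  move=> [[wA wB] wC] [[|[|[|[|m]]]] i4] _ //; rewrite /S/tnth/=//.
    by case: (a) wC.
  by case: (a) wC.
move=> ->; rewrite big_mkcond/= !big_ord_recl big_ord0.
rewrite !finset.in_setT /S /tnth/=.
by case: (a) => /=; rewrite preimage_setT probability_setT ?mule1 ?mul1e !muleA.
Qed.

(** Once [U] is fixed, the treatment depends on [V] alone and the outcome on [E a] alone, so
    independence factors each of the two disjoint cases. The arms [a] and [t] may differ. *)
Lemma joint_law (a t : bool) A : measurable A ->
  P (Y a @^-1` A `&` T @^-1` [set t%:R]) =
  (\sum_(u : bool) (1 / 2 * treatment_prob t u)%:E *
     P (E a @^-1` (quantile a u @^-1` A)))%E.
Proof.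
move=> mA.
have mQA u : measurable (quantile a u @^-1` A).
  by rewrite -[X in measurable X]setTI; exact: measurable_quantile.
pose S u := U @^-1` U_event u `&` V @^-1` V_event t u `&`
  E a @^-1` (quantile a u @^-1` A).
have PS u : P (S u) = ((1 / 2 * treatment_prob t u)%:E *
     P (E a @^-1` (quantile a u @^-1` A)))%E.
  rewrite /S indepUVE; first by rewrite P_U_event P_V_event EFinM.
  - exact: measurable_U_event.
  - exact: measurable_V_event.
  - exact: mQA.
have mS u : measurable (S u).
  apply: measurableI; first apply: measurableI.
  - rewrite -[X in measurable X]setTI; apply: measurable_funP => //.
    exact: measurable_U_event.
  - rewrite -[X in measurable X]setTI; apply: measurable_funP => //.
    exact: measurable_V_event.
  - by rewrite -[X in measurable X]setTI; apply: measurable_funP.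
have SE u w : S u w <-> [/\ (U w == 1) = u, V_event t u (V w) &
    A (quantile a u (E a w))].
  split; first by move=> [[/U_eventE]].
  by move=> [/U_eventE Uw Vw Aw].
have TE w : (T w = t%:R) <-> V_event t (U w == 1) (V w).
  rewrite /treatment /V_event; case: (t) => /=; rewrite in_itv/=;
    case: ifPn => //.
  - by split=> // /eqP; rewrite eq_sym oner_eq0.
  - by split=> // /eqP; rewrite oner_eq0.
have -> : Y a @^-1` A `&` T @^-1` [set t%:R] = S true `|` S false.
  apply/seteqP; split => w.
    move=> [Aw /TE Tw]; rewrite /preimage/= /potential_outcome in Aw.
    by case Uw: (U w == 1) in Aw Tw; [left|right]; apply/SE; split.
  by move=> [] /SE[Uw Vw Aw]; (split;
    [rewrite /preimage/= /potential_outcome Uw|apply/TE; rewrite Uw]).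
rewrite measureU//; first by rewrite big_bool/= !PS.
by apply/seteqP; split => // w [/SE[Uw _ _] /SE[]]; rewrite Uw.
Qed.

Lemma P_treatment (t : bool) : P (T @^-1` [set t%:R]) = (1 / 2)%:E.
Proof.
(* The joint law is applied to the sure event; the propensities 1/5 and 4/5 average to 1/2, and so
   do their complements. *)
rewrite -[X in P X]setTI -(preimage_setT (Y true)) joint_law//.
rewrite big_bool/= !preimage_setT !probability_setT !mule1 -EFinD.
by congr EFin; rewrite /treatment_prob /propensity; case: t; field.
Qed.

Definition marginal_weight a k : R := \sum_(u : bool) 1 / 2 * weight a u k.

(** By Bayes, P(U = u | T = a) is [treatment_prob a u], since the factors P(U = u) and P(T = a) are
    both 1/2 and cancel. *)
Definition conditional_weight a k : R :=
  \sum_(u : bool) treatment_prob a u * weight a u k.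

Lemma potential_outcome_law a :
  same_law (distribution P (Y a)) (histogram (marginal_weight a)).
Proof.
move=> A mA; rewrite /distribution /pushforward /=.
have mY : measurable (Y a @^-1` A).
  by rewrite -[X in measurable X]setTI; exact: measurable_potential_outcome.
have mT t : measurable (T @^-1` [set t]).
  by rewrite -[X in measurable X]setTI; exact: measurable_treatment.
(* Summing the joint law over both treatments removes the propensities, whose values for a given [u]
   add up to 1. *)
have -> : P (Y a @^-1` A) = (P (Y a @^-1` A `&` T @^-1` [set true%:R]) +
    P (Y a @^-1` A `&` T @^-1` [set false%:R]))%E.
  rewrite -measureU; [|exact: measurableI|exact: measurableI|].
    congr (P _); rewrite -setIUr setIidl// => w _ /=; rewrite /treatment.
    by case: ifPn; [left|right].
  by apply/seteqP; split => // w [[_ /= ->] [_ /= /eqP]]; rewrite oner_eq0.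
rewrite !joint_law// !big_bool/= !quantile_law// /histogram -!EFinM -!EFinD.
congr EFin; rewrite !big_ord_recr !big_ord0/= /marginal_weight !big_bool/=.
by rewrite /treatment_prob; ring.
Qed.

(** Consistency: on the event T = a the observed outcome is the potential outcome of arm [a]. *)
Lemma cond_distribution_outcome (a : bool) A :
  cond_distribution (outcome U V E0 E1 : {RV P >-> R}) (T @^-1` [set a%:R]) A =
  (fine (P (Y a @^-1` A `&` T @^-1` [set a%:R])) / (1 / 2))%:E.
Proof.
rewrite /cond_distribution /pushforward /cond_prob P_treatment.
congr (fine (P _) / _)%:E; apply/seteqP.
by split => w /= [+ Tw]; rewrite /outcome Tw; case: a Tw => Tw /=;
  rewrite ?subrr ?subr0 ?mul0r ?mul1r ?add0r ?addr0.
Qed.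

Lemma outcome_law_given_treatment (a : bool) :
  same_law (cond_distribution (outcome U V E0 E1 : {RV P >-> R})
    (T @^-1` [set a%:R])) (histogram (conditional_weight a)).
Proof.
move=> A mA; rewrite cond_distribution_outcome.
rewrite joint_law// big_bool/= !quantile_law// /histogram -!EFinM -!EFinD/=.
congr EFin; rewrite !big_ord_recr !big_ord0/= /conditional_weight !big_bool/=.
by field.
Qed.

Lemma marginal_weight_ge0 a k : 0 <= marginal_weight a k.
Proof.
apply: sumr_ge0 => u _.
by apply: mulr_ge0; [exact: divr_ge0|exact: weight_ge0].
Qed.

Lemma conditional_weight_ge0 a k : 0 <= conditional_weight a k.
Proof.
apply: sumr_ge0 => u _; apply: mulr_ge0; last exact: weight_ge0.
by rewrite /treatment_prob /propensity; case: a; case: u; lra.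
Qed.

Lemma laws_neq : ~ same_law (distribution P (Y true))
  (cond_distribution (outcome U V E0 E1 : {RV P >-> R})
      (T @^-1` [set true%:R])).
Proof.
move=> h; have mu1 := potential_outcome_law true.
have mu1' : same_law (distribution P (Y true))
    (histogram (conditional_weight true)).
  by move=> A mA; rewrite h// outcome_law_given_treatment.
have [f1 _] := density_histogram (marginal_weight_ge0 true) mu1.
have [f2 _] := density_histogram (conditional_weight_ge0 true) mu1'.
(* Equal laws would give one density with two values at 1/2, namely 7/20 and 13/50. *)
have half01 : 0%:R < (1 / 2 : R) < 1%:R by lra.
have := f1 0 _ isT half01; rewrite (f2 0 _ isT half01).
rewrite /marginal_weight /conditional_weight !big_bool /treatment_prob.
by rewrite /propensity /weight /breakpoint/=; lra.
Qed.

(** Independence of [Y true] and [T] factors the joint probability, and dividing by P(T = 1) leaves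
    the marginal law. *)
Lemma ignorable_laws_eq : weakly_ignorable U V E0 E1 ->
  same_law (distribution P (Y true))
    (cond_distribution (outcome U V E0 E1 : {RV P >-> R})
      (T @^-1` [set true%:R])).
Proof.
move=> /(_ true) hYT A mA; rewrite cond_distribution_outcome.
pose S := tnth [tuple A; [set 1]].
have mS : forall i, i \in [set: 'I_2]%SET -> measurable (S i).
  by move=> [[|[|m]] i2] _ //; rewrite /S/tnth/=.
have := @hYT _ _ mS.
have -> : \bigcap_(i in [set i | i \in [set: 'I_2]%SET])
      tnth [tuple Y true : {RV P >-> R}; T : {RV P >-> R}] i @^-1` S i =
    Y true @^-1` A `&` T @^-1` [set true%:R].
  apply/seteqP; split => w.
    by move=> h; split; [exact: (h (@Ordinal 2 0 isT) (finset.in_setT _))|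
      exact: (h (@Ordinal 2 1 isT) (finset.in_setT _))].
  by move=> [wA wT] [[|[|m]] i2] _ //; rewrite /S/tnth/=.
move=> ->; rewrite big_mkcond/= !big_ord_recl big_ord0.
rewrite !finset.in_setT /S /tnth/=.
rewrite mule1 (P_treatment true) fineM//.
  rewrite mulfK ?fineK//; last by rewrite mulf_neq0// invr_neq0.
  by apply: fin_num_measure; rewrite -[X in measurable X]setTI;
    exact: measurable_potential_outcome.
by apply: fin_num_measure; rewrite -[X in measurable X]setTI;
  exact: measurable_potential_outcome.
Qed.

End model.

(** * Comparison of the four histograms with the level 1/5 *)

Unset Implicit Arguments.

Theorem proposition21 (R : realType) (d : measure_display)
    (Om : measurableType d) (P : probability Om R)
    (U V E0 E1 : {RV P >-> R})
    (hindep : mutually_independent (tnth [tuple U; V; E0; E1]))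
    (hU0 : P (U @^-1` [set 0]) = (1 / 2)%:E)
    (hU1 : P (U @^-1` [set 1]) = (1 / 2)%:E)
    (hV : same_law (distribution P V) (uniform_prob (@ltr01 R)))
    (hE0 : same_law (distribution P E0) (uniform_prob (@ltr01 R)))
    (hE1 : same_law (distribution P E1) (uniform_prob (@ltr01 R))) :
  let T : {RV P >-> R} := treatment U V in
  let Ypot (a : bool) : {RV P >-> R} := potential_outcome U E0 E1 a in
  let Y : {RV P >-> R} := outcome U V E0 E1 in
  let mu (a : bool) := distribution P (Ypot a) in
  let nu (a : bool) := cond_distribution Y (T @^-1` [set a%:R]) in
  let Psi_L := Psi (20 / 100 : R) in
  [/\ Psi_L (mu false) = 1%N /\ Psi_L (nu false) = 1%N,
      Psi_L (mu true) = 2%N /\ Psi_L (nu true) = 2%N,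
      (Psi_L (mu true))%:Z - (Psi_L (mu false))%:Z = 1 /\
      (Psi_L (nu true))%:Z - (Psi_L (nu false))%:Z = 1,
      ~ same_law (mu true) (nu true)
    & ~ weakly_ignorable U V E0 E1].
Proof.
move=> T Ypot Y mu nu Psi_L.
have mu_law := potential_outcome_law hindep hU1 hV hE0 hE1.
have nu_law := outcome_law_given_treatment hindep hU1 hV hE0 hE1.
have mu_ge0 := @marginal_weight_ge0 R.
have nu_ge0 := @conditional_weight_ge0 R.
have lvl0 : (0 : R) < 20 / 100 by lra.
(* In arm 0 the smallest of the six heights is 4/15, above the level. *)
have mu0 : Psi_L (mu false) = 1%N.
  apply: (Psi_histogram_unimodal lvl0 (mu_ge0 _) (mu_law _)).
  by move=> [|[|[|//]]] _; rewrite /marginal_weight big_bool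
    /weight /breakpoint/=; lra.
have nu0 : Psi_L (nu false) = 1%N.
  apply: (Psi_histogram_unimodal lvl0 (nu_ge0 _) (nu_law _)).
  by move=> [|[|[|//]]] _; rewrite /conditional_weight big_bool
    /treatment_prob /propensity /weight /breakpoint/=; lra.
(* In arm 1 both quantile functions jump over ]1, 2], so the middle height is 0 whatever the mixing
   weights; the outer heights are at least 13/50. *)
have mu1 : Psi_L (mu true) = 2%N.
  by apply: (Psi_histogram_bimodal lvl0 (mu_ge0 _) (mu_law _));
    rewrite /marginal_weight big_bool /weight /breakpoint/=; lra.
have nu1 : Psi_L (nu true) = 2%N.
  by apply: (Psi_histogram_bimodal lvl0 (nu_ge0 _) (nu_law _));
    rewrite /conditional_weight big_bool
      /treatment_prob /propensity /weight /breakpoint/=; lra.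
have neq := laws_neq hindep hU1 hV hE0 hE1.
split=> //; first by rewrite mu0 mu1 nu0 nu1.
by move=> /(ignorable_laws_eq hindep hU1 hV).
Qed.
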